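(* Let $q\in[0,1)$. A $\mathbb C^{n\times m}$-valued function $T$ analytic at the origin is $q$-rational if and only if $T$ is the $q$-Borel transform of a $\mathbb C^{n\times m}$-valued rational function $F$ analytic at the origin, i.e. $T(z)=\sum_{k=0}^\infty\frac{z^k}{[k]_q!}F_k$ where $F(z)=\sum_{k=0}^\infty z^kF_k$.
   Context: $[0]_q=1$, $[k]_q=1+q+\cdots+q^{k-1}$ ($k\ge1$), $[k]_q!=\prod_{j=1}^k[j]_q$, $[0]_q!=1$. A $\mathbb C^{n\times m}$-valued function $T$ analytic at the origin is called $q$-rational if there exist $N\in\mathbb N_0$ and $(C,A,B)\in\mathbb C^{n\times N}\times\mathbb C^{N\times N}\times\mathbb C^{N\times m}$ such that $T(z)=C\prod_{j=0}^\infty(I_N-(1-q)zq^jA)^{-1}B$ in a neighbourhood of the origin (convention $q^0=1$). *)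

(* Defs.v *)
From HB Require Import structures.
From mathcomp Require Import all_boot all_order all_algebra.
From mathcomp Require Import complex.
From mathcomp Require Import all_classical all_reals all_analysis.
Import Order.TTheory GRing.Theory Num.Theory.
Import numFieldNormedType.Exports.
Set Implicit Arguments. Unset Strict Implicit. Unset Printing Implicit Defensive.
Local Open Scope ring_scope.
Local Open Scope complex_scope.
Local Open Scope classical_set_scope.

Section QRational.
Variable R : realType.
Local Notation C := R[i].

(* [k]_q, with the paper's convention [0]_q = 1 *)
Definition qint (q : R) (k : nat) : R :=
  if k is 0 then 1 else \sum_(i < k) q ^+ i.

Definition qfact (q : R) (k : nat) : R := \prod_(j < k) qint q j.+1.

Variables n m : nat.

Definition mx_cvg (p r : nat) (u : nat -> 'M[C]_(p, r)) (L : 'M[C]_(p, r)) : Prop :=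
  forall (i : 'I_p) (j : 'I_r) (e : C), 0 < e ->
    exists K : nat, forall k : nat, (K <= k)%N -> `|u k i j - L i j| < e.

Definition mx_series_to (c : nat -> 'M[C]_(n, m)) (z : C) (L : 'M[C]_(n, m)) : Prop :=
  mx_cvg (fun K => \sum_(k < K) (z ^+ k) *: c k) L.

Definition near0 (P : C -> Prop) : Prop :=
  exists r : C, 0 < r /\ forall z : C, `|z| < r -> P z.

Definition analytic_at0 (T : C -> 'M[C]_(n, m)) : Prop :=
  exists c : nat -> 'M[C]_(n, m), near0 (fun z => mx_series_to c z (T z)).

Definition q_rational (q : R) (T : C -> 'M[C]_(n, m)) : Prop :=
  exists (N : nat) (Cm : 'M[C]_(n, N)) (A : 'M[C]_N) (B : 'M[C]_(N, m)),
    near0 (fun z =>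
      (forall j : nat, (1%:M - (((1 - q) * q ^+ j)%:C * z) *: A) \in unitmx) /\
      exists P : 'M[C]_N,
        mx_cvg (fun J => \prod_(j < J) invmx (1%:M - (((1 - q) * q ^+ j)%:C * z) *: A)) P
        /\ T z = Cm *m P *m B).

Definition is_rational_fun (F : C -> 'M[C]_(n, m)) : Prop :=
  exists (P : 'M[{poly C}]_(n, m)) (d : {poly C}), d != 0 /\
    forall z : C, d.[z] != 0 -> F z = (d.[z])^-1 *: map_mx (fun p => p.[z]) P.

End QRational.

(* Main.v *)
(** Put [E(w) = \sum_k w^k A^k / [k]_q!]. Comparing coefficients gives
    [(1 - (1 - q) w A) E(w) = E(q w)], hence
    [\prod_(j < J) (1 - (1 - q) z q^j A)^-1 * E(q^J z) = E(z)]; as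
    [E(q^J z) -> 1], the infinite product equals [E(z)] for small [z]. So the
    q-rational functions are the q-Borel transforms of the functions
    [C (1 - z A)^-1 B = \sum_k z^k C A^k B]. By Cramer's rule these are
    rational and analytic at 0; conversely, clearing denominators in a rational
    function analytic at 0 shows that its Taylor coefficients satisfy a linear
    recurrence, so they have the form [C A^k B]. *)

Require Import Defs.
From HB Require Import structures.
From mathcomp Require Import all_boot all_order all_algebra.
From mathcomp Require Import complex ring lra zify.
From mathcomp Require Import all_classical all_reals all_analysis.
Import Order.TTheory GRing.Theory Num.Theory.
Import numFieldNormedType.Exports.
Set Implicit Arguments. Unset Strict Implicit. Unset Printing Implicit Defensive.
Local Open Scope ring_scope.
Local Open Scope complex_scope.
Local Open Scope classical_set_scope.

Import ComplexField.Normc.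

(** * The entrywise sum norm and limits of complex matrices *)

Section MatrixNorm.
Variable R : realType.
Local Notation C := R[i].

(** Values lie in [R], through [normc], so that estimates and limits can use real analysis; the sum
    over entries is submultiplicative for rectangular matrices too. *)
Definition mxn p r (A : 'M[C]_(p, r)) : R := \sum_i \sum_j normc (A i j).

Lemma norm_normc (x : C) : `|x| = (normc x)%:C.
Proof. by []. Qed.

Lemma normc_ge0 (x : C) : 0 <= normc x.
Proof. by case: x => a b; rewrite /normc sqrtr_ge0. Qed.

Lemma normcR (a : R) : normc a%:C = `|a|.
Proof. by rewrite /normc /= expr0n addr0 sqrtr_sqr. Qed.

Lemma normcD (x y : C) : normc (x + y) <= normc x + normc y.
Proof. exact: (@le_normcD R x y). Qed.

Lemma normcX (x : C) k : normc (x ^+ k) = normc x ^+ k.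
Proof. by elim: k => [|k IH]; rewrite ?expr0 ?normc1 // !exprS normcM IH. Qed.

Lemma normc_sum I (s : seq I) (P : pred I) (f : I -> C) :
  normc (\sum_(i <- s | P i) f i) <= \sum_(i <- s | P i) normc (f i).
Proof.
elim/big_ind2: _ => [|x1 x2 y1 y2 h1 h2|//]; first by rewrite normc0.
exact: le_trans (normcD _ _) (lerD h1 h2).
Qed.

Lemma mxn_ge0 p r (A : 'M[C]_(p, r)) : 0 <= mxn A.
Proof. by do 2![apply: sumr_ge0 => ? _]; apply: normc_ge0. Qed.

Lemma normc_le_mxn p r (A : 'M[C]_(p, r)) i j : normc (A i j) <= mxn A.
Proof.
rewrite /mxn (bigD1 i) //= (bigD1 j) //= -addrA lerDl addr_ge0 //.
  by apply: sumr_ge0 => ? _; apply: normc_ge0.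
by do 2![apply: sumr_ge0 => ? _]; apply: normc_ge0.
Qed.

Lemma mxn0 p r : mxn (0 : 'M[C]_(p, r)) = 0.
Proof. by rewrite /mxn big1 // => i _; rewrite big1 // => j _; rewrite mxE normc0. Qed.

Lemma mxn0_eq0 p r (A : 'M[C]_(p, r)) : mxn A <= 0 -> A = 0.
Proof.
move=> A0; apply/matrixP => i j; rewrite mxE; apply: eq0_normc.
by apply/eqP; rewrite eq_le normc_ge0 andbT (le_trans (normc_le_mxn A i j)).
Qed.

Lemma mxnD p r (A B : 'M[C]_(p, r)) : mxn (A + B) <= mxn A + mxn B.
Proof.
rewrite /mxn -big_split ler_sum // => i _; rewrite -big_split ler_sum // => j _.
by rewrite mxE normcD.
Qed.

Lemma mxnZ p r a (A : 'M[C]_(p, r)) : mxn (a *: A) = normc a * mxn A.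
Proof.
rewrite /mxn mulr_sumr; apply: eq_bigr => i _; rewrite mulr_sumr.
by apply: eq_bigr => j _; rewrite mxE normcM.
Qed.

Lemma mxnN p r (A : 'M[C]_(p, r)) : mxn (- A) = mxn A.
Proof.
by rewrite -scaleN1r mxnZ -(rmorphN1 (real_complex R)) normcR normrN1 mul1r.
Qed.

Lemma mxn_sum p r I (s : seq I) (P : pred I) (f : I -> 'M[C]_(p, r)) :
  mxn (\sum_(i <- s | P i) f i) <= \sum_(i <- s | P i) mxn (f i).
Proof.
elim/big_ind2: _ => [|x1 x2 y1 y2 h1 h2|//]; first by rewrite mxn0.
exact: le_trans (mxnD _ _) (lerD h1 h2).
Qed.

Lemma mxnM p r s (A : 'M[C]_(p, r)) (B : 'M[C]_(r, s)) :
  mxn (A *m B) <= mxn A * mxn B.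
Proof.
rewrite /mxn mulr_suml ler_sum // => i _.
apply: (@le_trans _ _ (\sum_k \sum_j normc (A i j) * normc (B j k))).
  apply: ler_sum => k _; rewrite mxE (le_trans (normc_sum _ _ _)) //.
  by rewrite ler_sum // => j _; rewrite normcM.
rewrite exchange_big mulr_suml ler_sum //= => j _.
rewrite -mulr_sumr ler_wpM2l ?normc_ge0 // (bigD1 j) //= lerDl.
by do 2![apply: sumr_ge0 => ? _]; apply: normc_ge0.
Qed.

(** The exponent starts at 1 because the identity matrix has norm [p], so the bound fails at
    exponent 0 when [p > 1]. *)
Lemma mxnX p (A : 'M[C]_p) k : mxn (A ^+ k.+1) <= mxn A ^+ k.+1.
Proof.
elim: k => [|k IH]; first by rewrite !expr1.
rewrite exprS [leRHS]exprS (le_trans (mxnM _ _)) //.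
by rewrite ler_wpM2l ?mxn_ge0.
Qed.

Lemma cvg_sum0 (I : finType) (f : I -> nat -> R) :
  (forall i, f i k @[k --> \oo] --> (0 : R)) ->
  (\sum_i f i k) @[k --> \oo] --> (0 : R).
Proof.
move=> f0; elim: (index_enum I) => [|i s IH].
  by under eq_fun do rewrite big_nil; exact: cvg_cst.
rewrite [X in X @ _](_ : _ = fun k => f i k + \sum_(j <- s) f j k); last first.
  by apply/funext => k; rewrite big_cons.
by rewrite -[0 in X in _ --> X](addr0 0); apply: cvgD.
Qed.

Lemma mx_cvgP p r (u : nat -> 'M[C]_(p, r)) L :
  mx_cvg u L <-> (mxn (u k - L)) @[k --> \oo] --> (0 : R).
Proof.
split=> [uL|uL i j e].
  apply: cvg_sum0 => i; apply: cvg_sum0 => j.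
  apply/cvgr0Pnorm_lt => e e0.
  have /uL : 0 < e%:C :> C by rewrite ltcR.
  move=> /(_ i j) [K HK]; exists K => // k /= /HK.
  by rewrite norm_normc ltcR !mxE ger0_norm ?normc_ge0.
(* A complex [e] with [0 < e] is real: the order on [C] forces its imaginary part to vanish. *)
case: e => e e'; rewrite ltcE /= => /andP [/eqP -> e0].
have /cvgr0Pnorm_lt /(_ e e0) [K _ HK] := uL.
exists K => k /HK /=; rewrite ger0_norm ?mxn_ge0 // => h.
rewrite norm_normc -[_ +i* _]/(e%:C) ltcR; apply: le_lt_trans h.
by have := normc_le_mxn (u k - L) i j; rewrite !mxE.
Qed.

Lemma mx_cvg_dominated p r (u : nat -> 'M[C]_(p, r)) L (f : nat -> R) :
  (forall k, mxn (u k - L) <= f k) -> f @ \oo --> (0 : R) -> mx_cvg u L.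
Proof.
move=> uf f0; apply/mx_cvgP; apply: (@squeeze_cvgr _ _ _ _ (cst 0) f) => //.
  by apply: nearW => k; rewrite mxn_ge0 uf.
exact: cvg_cst.
Qed.

Lemma mx_cvg_near p r (u v : nat -> 'M[C]_(p, r)) L K :
  (forall k, (K <= k)%N -> u k = v k) -> mx_cvg u L -> mx_cvg v L.
Proof.
move=> uv uL i j e e0; have [K' HK] := uL i j e e0.
exists (maxn K K') => k; rewrite geq_max => /andP [h1 h2].
by rewrite -uv // HK.
Qed.

Lemma mx_cvg_cst p r (L : 'M[C]_(p, r)) : mx_cvg (fun=> L) L.
Proof. by move=> i j e e0; exists 0%N => k _; rewrite subrr normr0. Qed.

Lemma mx_cvgS p r (u : nat -> 'M[C]_(p, r)) L :
  mx_cvg (fun k => u k.+1) L <-> mx_cvg u L.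
Proof.
split=> uL i j e e0; have [K HK] := uL i j e e0.
  by exists K.+1 => -[//|k] /HK.
by exists K => k Kk; apply/HK/leqW.
Qed.

Lemma mx_cvgD p r (u v : nat -> 'M[C]_(p, r)) U V :
  mx_cvg u U -> mx_cvg v V -> mx_cvg (fun k => u k + v k) (U + V).
Proof.
move=> /mx_cvgP uU /mx_cvgP vV.
apply: (@mx_cvg_dominated _ _ _ _ (fun k => mxn (u k - U) + mxn (v k - V))).
  by move=> k; rewrite opprD addrACA mxnD.
by rewrite -[0 in X in _ --> X](addr0 0); apply: cvgD.
Qed.

Lemma mx_cvgM p r s (u : nat -> 'M[C]_(p, r)) (v : nat -> 'M[C]_(r, s)) U V :
  mx_cvg u U -> mx_cvg v V -> mx_cvg (fun k => u k *m v k) (U *m V).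
Proof.
move=> /mx_cvgP uU /mx_cvgP vV.
apply: (@mx_cvg_dominated _ _ _ _ (fun k => mxn (u k - U) * mxn (v k - V)
   + mxn U * mxn (v k - V) + mxn (u k - U) * mxn V)).
  move=> k; have -> : u k *m v k - U *m V =
     (u k - U) *m (v k - V) + U *m (v k - V) + (u k - U) *m V.
    rewrite -mulmxDl subrK mulmxBr mulmxBl addrA subrK //.
  rewrite (le_trans (mxnD _ _)) // lerD ?mxnM //.
  by rewrite (le_trans (mxnD _ _)) // lerD ?mxnM.
rewrite -[0 in X in _ --> X](_ : 0 * 0 + mxn U * 0 + 0 * mxn V = 0).
  by apply: cvgD; first apply: cvgD; apply: cvgM => //; apply: cvg_cst.
by rewrite mulr0 mul0r mulr0 !addr0.
Qed.

Lemma mx_cvgMl p r s (A : 'M[C]_(p, r)) (v : nat -> 'M[C]_(r, s)) V :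
  mx_cvg v V -> mx_cvg (fun k => A *m v k) (A *m V).
Proof. exact/mx_cvgM/mx_cvg_cst. Qed.

Lemma mx_cvgMr p r s (u : nat -> 'M[C]_(p, r)) (B : 'M[C]_(r, s)) U :
  mx_cvg u U -> mx_cvg (fun k => u k *m B) (U *m B).
Proof. by move=> h; apply/mx_cvgM/mx_cvg_cst. Qed.

Lemma mx_cvgZ p r a (u : nat -> 'M[C]_(p, r)) U :
  mx_cvg u U -> mx_cvg (fun k => a *: u k) (a *: U).
Proof.
move=> /(@mx_cvgMl _ _ _ a%:M); rewrite mul_scalar_mx.
by apply: (@mx_cvg_near _ _ _ _ _ 0) => k _; rewrite mul_scalar_mx.
Qed.

Lemma mxn_cvg_le p r (u : nat -> 'M[C]_(p, r)) U (b : R) :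
  mx_cvg u U -> (forall k, mxn (u k) <= b) -> mxn U <= b.
Proof.
move=> /mx_cvgP /cvgr0Pnorm_lt uU ub; apply/ler_addgt0Pr => e /uU [K _ HK].
have := HK K (leqnn K); rewrite /= ger0_norm ?mxn_ge0 // => /ltW h.
have -> : U = u K - (u K - U) by rewrite opprB addrC subrK.
by rewrite (le_trans (mxnD _ _)) // mxnN lerD.
Qed.

Lemma mx_cvg_unique p r (u : nat -> 'M[C]_(p, r)) U V :
  mx_cvg u U -> mx_cvg u V -> U = V.
Proof.
move=> uU /(mx_cvgZ (-1)) /(mx_cvgD uU) h; apply/eqP.
rewrite -subr_eq0 -scaleN1r; apply/eqP/mxn0_eq0/(mxn_cvg_le h) => k.
by rewrite scaleN1r subrr mxn0.
Qed.

Lemma mx_cvg_entrywise p r (u : nat -> 'M[C]_(p, r)) :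
  (forall i j, exists l : C,
     normc (u k i j - l) @[k --> \oo] --> (0 : R)) -> exists L, mx_cvg u L.
Proof.
move=> h; pose l i j := projT1 (cid (h i j)).
exists (\matrix_(i, j) l i j); apply/mx_cvgP.
apply: cvg_sum0 => i; apply: cvg_sum0 => j.
have -> : (fun k => normc ((u k - \matrix_(i, j) l i j) i j)) =
          (fun k => normc (u k i j - l i j)) by apply/funext=> k; rewrite !mxE.
exact: projT2 (cid (h i j)).
Qed.

Lemma Re_le_normc (x : C) : `|complex.Re x| <= normc x.
Proof.
by case: x => a b; rewrite /normc /= -sqrtr_sqr ler_wsqrtr // lerDl sqr_ge0.
Qed.

Lemma Im_le_normc (x : C) : `|complex.Im x| <= normc x.
Proof.
by case: x => a b; rewrite /normc /= -sqrtr_sqr ler_wsqrtr // lerDr sqr_ge0.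
Qed.

Lemma normc_le_ReIm (x : C) : normc x <= `|complex.Re x| + `|complex.Im x|.
Proof.
rewrite [x in normc x]complexE (le_trans (normcD _ _)) // normcM !normcR lerD //.
by rewrite {1}/normc expr0n expr1n add0r sqrtr1 mul1r.
Qed.

Lemma is_cvg_geometric_bound (f : nat -> R) (c : R) : 0 <= c < 1 ->
  (forall k, `|f k| <= c ^+ k) -> cvgn (fun K => \sum_(k < K) f k).
Proof.
move=> /andP [c0 c1] fc.
have -> : (fun K => \sum_(k < K) f k) = series f.
  by apply/funext => K; rewrite /series /= big_mkord.
apply: normed_cvg; apply: (@series_le_cvg _ _ (geometric 1 c)) => //.
- by move=> k; rewrite /=.
- by move=> k; rewrite /= mul1r exprn_ge0.
- by move=> k; rewrite /= mul1r fc.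
- by apply: is_cvg_geometric_series; rewrite ger0_norm.
Qed.

Lemma geometric_sum_le2 (x : R) K : 0 <= x <= 2^-1 -> \sum_(k < K) x ^+ k <= 2.
Proof.
move=> /andP [x0 x1].
(* The bound 2 alone is not inductive; the subtracted term absorbs the next power because
   [2 * x <= 1]. *)
suff : \sum_(k < K) x ^+ k <= 2 - 2 * x ^+ K.
  by move=> /le_trans; apply; rewrite gerBl mulr_ge0 ?exprn_ge0.
elim: K => [|K IH]; first by rewrite big_ord0 expr0 mulr1 subrr.
rewrite big_ord_recr /= exprS.
by have := exprn_ge0 K x0; move: IH; set y := x ^+ _; nra.
Qed.

(** Completeness of [R] enters here: real and imaginary parts of each entry are dominated by the
    geometric series, and their limits are assembled entrywise. *)
Lemma mx_series_geometric p r (u : nat -> 'M[C]_(p, r)) (c : R) : 0 <= c < 1 ->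
  (forall k, mxn (u k) <= c ^+ k) -> exists L, mx_cvg (fun K => \sum_(k < K) u k) L.
Proof.
move=> c01 uc; apply: mx_cvg_entrywise => i j.
have bnd k : normc (u k i j) <= c ^+ k.
  exact: le_trans (normc_le_mxn _ _ _) (uc k).
have /cvg_ex [/= a ha] := is_cvg_geometric_bound c01
  (fun k => le_trans (Re_le_normc (u k i j)) (bnd k)).
have /cvg_ex [/= b hb] := is_cvg_geometric_bound c01
  (fun k => le_trans (Im_le_normc (u k i j)) (bnd k)).
exists (a +i* b).
apply: (@squeeze_cvgr _ _ _ _ (cst 0) (fun K => `|\sum_(k < K) complex.Re (u k i j) - a|
   + `|\sum_(k < K) complex.Im (u k i j) - b|)).
- apply: nearW => K; rewrite normc_ge0 (le_trans (normc_le_ReIm _)) //=.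
  rewrite summxE raddfB raddfB /=.
  by rewrite !raddf_sum.
- exact: cvg_cst.
- rewrite -[0 in X in _ --> X](_ : `|a - a| + `|b - b| = 0).
    by apply: cvgD; apply: cvg_norm; apply: cvgB => //; apply: cvg_cst.
  by rewrite !subrr normr0 addr0.
Qed.

End MatrixNorm.

(** * State-space realizations [C A^k B] of matrix sequences *)

Section Realization.
Variable K : fieldType.

(** These are the Taylor coefficients at 0 of the transfer function [C (1 - z A)^-1 B]. *)
Definition realizable n m (F : nat -> 'M[K]_(n, m)) : Prop :=
  exists (N : nat) (Cm : 'M[K]_(n, N)) (A : 'M[K]_N) (B : 'M[K]_(N, m)),
    forall k, F k = Cm *m A ^+ k *m B.

Lemma realizable_ext n m (F G : nat -> 'M[K]_(n, m)) :
  F =1 G -> realizable F -> realizable G.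
Proof. by move=> FG [N [Cm [A [B h]]]]; exists N, Cm, A, B => k; rewrite -FG. Qed.

Lemma realizable0 n m : realizable (fun=> 0 : 'M[K]_(n, m)).
Proof. by exists 0%N, 0, 0, 0 => k; rewrite mulmx0. Qed.

Lemma exp_block_diag_mx N1 N2 (A1 : 'M[K]_N1) (A2 : 'M[K]_N2) k :
  block_mx A1 0 0 A2 ^+ k = block_mx (A1 ^+ k) 0 0 (A2 ^+ k).
Proof.
elim: k => [|k IH]; first by rewrite !expr0 -scalar_mx_block.
rewrite !exprS IH -[LHS]/(_ *m _) mulmx_block.
by rewrite !mulmx0 !mul0mx !addr0 !add0r.
Qed.

(** Parallel connection of two systems: a block-diagonal state matrix keeps their powers
    separate. *)
Lemma realizableD n m (F G : nat -> 'M[K]_(n, m)) :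
  realizable F -> realizable G -> realizable (fun k => F k + G k).
Proof.
move=> [N1 [C1 [A1 [B1 h1]]]] [N2 [C2 [A2 [B2 h2]]]].
exists (N1 + N2)%N, (row_mx C1 C2), (block_mx A1 0 0 A2), (col_mx B1 B2) => k.
rewrite exp_block_diag_mx mul_row_block !mulmx0 addr0 add0r mul_row_col.
by rewrite h1 h2.
Qed.

Lemma realizable_sum n m (I : Type) (s : seq I) (F : I -> nat -> 'M[K]_(n, m)) :
  (forall i, realizable (F i)) -> realizable (fun k => \sum_(i <- s) F i k).
Proof.
move=> h; elim: s => [|i s IH].
  by apply: realizable_ext (realizable0 n m) => k; rewrite big_nil.
by apply: realizable_ext (realizableD (h i) IH) => k; rewrite big_cons.
Qed.

Lemma realizable_mul n m p r (L : 'M[K]_(p, n)) (M : 'M[K]_(m, r))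
    (F : nat -> 'M[K]_(n, m)) :
  realizable F -> realizable (fun k => L *m F k *m M).
Proof.
move=> [N [Cm [A [B h]]]]; exists N, (L *m Cm), A, (B *m M) => k.
by rewrite h !mulmxA.
Qed.

(** Putting each entry in its place with [delta_mx] factors writes [F] as a finite sum of realizable
    sequences. *)
Lemma realizable_entries n m (F : nat -> 'M[K]_(n, m)) :
  (forall i j, realizable (fun k => (F k i j)%:M : 'M[K]_1)) -> realizable F.
Proof.
move=> h.
have := realizable_sum (index_enum 'I_n) (fun i => realizable_sum (index_enum 'I_m)
  (fun j => realizable_mul (delta_mx i 0) (delta_mx 0 j) (h i j))).
apply: realizable_ext => k; rewrite [RHS]matrix_sum_delta.
apply: eq_bigr => i _; apply: eq_bigr => j _.
by rewrite mul_mx_scalar -scalemxAl mul_delta_mx.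
Qed.

(** The companion matrix [A] moves the window [(f k, ..., f (k + M))] one step on, and the row
    [delta_mx 0 0] reads off its first entry. *)
Lemma realizable_recurrence M (a : nat -> K) (f : nat -> K) :
  (forall l, f (l + M.+1)%N = \sum_(j < M.+1) a j * f (l + j)%N) ->
  realizable (fun k => (f k)%:M : 'M[K]_1).
Proof.
move=> rec.
pose A : 'M[K]_M.+1 :=
  \matrix_(i, j) if (i < M)%N then ((j : nat) == i.+1)%:R else a j.
pose v k : 'cV[K]_M.+1 := \col_i f (k + i)%N.
have Av k : A ^+ k *m v 0%N = v k.
  elim: k => [|k IH]; first by rewrite mul1mx.
  rewrite exprS -mulmxA IH; apply/matrixP => i j; rewrite !mxE.
  have [iM|Mi] := ltnP i M.
    have iM' : (i.+1 < M.+1)%N by [].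
    rewrite (bigD1 (Ordinal iM')) //= big1 => [|l li].
      by rewrite !mxE iM eqxx mul1r addr0 addnS.
    rewrite !mxE iM; case: eqP => [e|_]; last by rewrite mul0r.
    by case/eqP: li; apply/val_inj.
  have -> : (k.+1 + i = k + M.+1)%N by have := ltn_ord i; lia.
  rewrite rec; apply: eq_bigr => l _; rewrite !mxE ltnNge Mi //.
exists M.+1, (delta_mx 0 0), A, (v 0%N) => k.
rewrite -mulmxA Av -rowE; apply/matrixP => i j.
by rewrite !mxE !ord1 eqxx addn0.
Qed.

(** The denominator may vanish at 0, so the recurrence is solved for the term carrying the lowest
    nonzero coefficient [d_s], at degrees beyond the size of [p]. *)
Lemma realizable_poly_conv (d p : {poly K}) (f : nat -> K) : d != 0 ->
  (forall k, \sum_(i < k.+1) d`_i * f (k - i)%N = p`_k) ->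
  realizable (fun k => (f k)%:M : 'M[K]_1).
Proof.
move=> d0 h.
have exs : exists s, d`_s != 0 by exists (size d).-1; rewrite -lead_coefE lead_coef_eq0.
case: (ex_minnP exs) => s ds mins.
have [M dM pM] : exists2 M, (size d <= M)%N & (size p <= M)%N.
  by exists (maxn (size d) (size p)); rewrite ?leq_maxl ?leq_maxr.
apply: (@realizable_recurrence M (fun j => - (d`_(M.+1 + s - j) / d`_s))) => l.
have := h (l + M.+1 + s)%N; rewrite [p`__]nth_default; last by apply: leq_trans pM _; lia.
(* Indexed by the argument of [f], the sum is cut at [l] and [l + M.+1]: below [l] the index into
   [d] is at least [size d], above [l + M.+1] it is less than [s], and at [l + M.+1] it equals
   [s]. *)
rewrite (reindex_inj rev_ord_inj) /=.
rewrite (eq_bigr (fun i : 'I_(l + M.+1 + s).+1 => d`_(l + M.+1 + s - i) * f i)); last first.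
  move=> i _; rewrite subSS; congr (_ * f _). have := ltn_ord i; lia.
rewrite -(big_mkord xpredT (fun i => d`_(l + M.+1 + s - i) * f i)).
rewrite (@big_cat_nat _ _ _ l) //=; last by lia.
rewrite big_nat big1 ?add0r; last first.
  by move=> i /andP [_ il]; rewrite nth_default ?mul0r //; apply: leq_trans dM _; lia.
rewrite (@big_cat_nat _ _ _ (l + M.+1)) /=; [|lia|lia].
rewrite [X in _ + X]big_ltn; last by lia.
rewrite [X in _ + (_ + X)]big_nat [X in _ + (_ + X)]big1 ?addr0; last first.
  move=> i /andP [il iu]; have [->|/mins] := eqVneq (d`_(l + M.+1 + s - i)) 0.
    by rewrite mul0r.
  by lia.
have -> : (l + M.+1 + s - (l + M.+1) = s)%N by lia.
rewrite -{1}[l]add0n big_addn.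
have -> : (l + M.+1 - l = M.+1)%N by lia.
rewrite big_mkord => /eqP; rewrite addrC addr_eq0 => /eqP e.
apply: (mulfI ds); rewrite e mulr_sumr -sumrN; apply: eq_bigr => j _.
have -> : (l + M.+1 + s - (j + l) = M.+1 + s - j)%N by lia.
by rewrite mulNr mulrN mulrA [d`_s * (_ / _)]mulrCA divff // mulr1 (addnC l).
Qed.

End Realization.

(** * The matrix q-exponential and the infinite product *)

Section QExponential.
Variables (R : realType) (q : R).
Hypotheses (q0 : 0 <= q) (q1 : q < 1).
Local Notation C := R[i].

Lemma qint_ge1 k : 1 <= qint q k.+1.
Proof. by rewrite /qint big_ord_recl expr0 lerDl sumr_ge0 // => i _; rewrite exprn_ge0. Qed.

Lemma qfact_ge1 k : 1 <= qfact q k.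
Proof.
rewrite /qfact; elim/big_ind: _ => // [x y x1 y1|i _]; last exact: qint_ge1.
by rewrite -[1]mulr1 ler_pM.
Qed.

Lemma qintE k : (1 - q) * qint q k.+1 = 1 - q ^+ k.+1.
Proof. by rewrite /qint -[RHS]opprB subrX1 -mulNr opprB. Qed.

(** This is the functional equation [(1 - (1 - q) w A) E(w) = E(q w)] read off coefficient by
    coefficient. *)
Lemma qfactV_rec k : (1 - q) * (qfact q k)^-1 = (1 - q ^+ k.+1) * (qfact q k.+1)^-1.
Proof.
rewrite -qintE {2}/qfact big_ord_recr /= -/(qfact q k).
have h1 : qfact q k != 0 by rewrite gt_eqF // (lt_le_trans ltr01) ?qfact_ge1.
have h2 : qint q k.+1 != 0 by rewrite gt_eqF // (lt_le_trans ltr01) ?qint_ge1.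
by field; rewrite h1 h2.
Qed.

Variables (N : nat) (A : 'M[C]_N).

Definition qexp_term (w : C) k : 'M[C]_N := w ^+ k *: (((qfact q k)^-1)%:C *: A ^+ k).

Lemma mxn_qexp_term w k : mxn (qexp_term w k.+1) <= (normc w * mxn A) ^+ k.+1.
Proof.
rewrite !mxnZ normcX normcR exprMn ler_wpM2l ?exprn_ge0 ?normc_ge0 //.
have f1 := qfact_ge1 k.+1.
rewrite ger0_norm ?invr_ge0 ?(le_trans ler01) //.
rewrite (le_trans _ (mxnX A k)) // ler_piMl ?mxn_ge0 //.
by rewrite invf_le1 // (lt_le_trans ltr01).
Qed.

Lemma qexp_ex (w : C) : normc w * mxn A <= 2^-1 ->
  exists E, mx_cvg (fun K => \sum_(k < K) qexp_term w k) E /\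
            mxn (E - 1%:M) <= 2 * (normc w * mxn A).
Proof.
set x := normc w * mxn A => xh.
have x0 : 0 <= x by rewrite mulr_ge0 ?normc_ge0 ?mxn_ge0.
(* The constant term is split off: its norm is [N], not 1, and the remaining series is exactly
   [E - 1]. *)
have [E' hE] : exists L, mx_cvg (fun K => \sum_(k < K) qexp_term w k.+1) L.
  apply: (@mx_series_geometric _ _ _ (fun k => qexp_term w k.+1) x); first by lra.
  move=> k; apply: le_trans (mxn_qexp_term w k) _.
  by rewrite -/x exprS ler_piMl ?exprn_ge0 //; lra.
exists (1%:M + E'); split.
  apply/mx_cvgS; have := mx_cvgD (mx_cvg_cst 1%:M) hE.
  apply: (@mx_cvg_near _ _ _ _ _ _ 0) => K _; rewrite big_ord_recl; congr (_ + _).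
  by rewrite /qexp_term expr0 scale1r /qfact big_ord0 invr1 scale1r expr0.
rewrite addrC addKr; apply: (mxn_cvg_le hE) => K.
apply: le_trans (mxn_sum _ _ _) _.
apply: (@le_trans _ _ (\sum_(k < K) x ^+ k.+1)).
  by apply: ler_sum => k _; apply: mxn_qexp_term.
under eq_bigr do rewrite exprSr.
by rewrite -mulr_suml ler_wpM2r // geometric_sum_le2 ?x0.
Qed.

(** Multiplication by the factor raises degrees by one, so truncation leaves exactly one uncancelled
    term, of degree [K.+1]. *)
Lemma qexp_functional_partial (w : C) K :
  (1%:M - ((1 - q)%:C * w) *: A) *m (\sum_(k < K.+1) qexp_term w k) =
  \sum_(k < K.+1) qexp_term (q%:C * w) k
  - (w ^+ K.+1 * ((1 - q) * (qfact q K)^-1)%:C) *: A ^+ K.+1.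
Proof.
have key k : ((1 - q)%:C * w) *: A *m qexp_term w k =
    (w ^+ k.+1 * ((1 - q) * (qfact q k)^-1)%:C) *: A ^+ k.+1.
  rewrite /qexp_term -!scalemxAr -scalemxAl -[A *m _]/(A * _) -exprS !scalerA; congr (_ *: _).
  by rewrite exprS rmorphM /=; ring.
elim: K => [|K IH].
  rewrite !big_ord_recr !big_ord0 /= !add0r mulmxBl key mul1mx.
  by rewrite /qexp_term !expr0.
rewrite big_ord_recr mulmxDr IH [in RHS]big_ord_recr /= -!addrA; congr (_ + _).
rewrite mulmxBl mul1mx key addrA; congr (_ - _).
rewrite /qexp_term !scalerA -scaleNr -scalerDl; congr (_ *: _).
by rewrite qfactV_rec exprMn rmorphM rmorphB rmorph1 rmorphXn /=; ring.
Qed.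

Lemma qexp_functional (w : C) E E' : normc w * mxn A < 1 ->
  mx_cvg (fun K => \sum_(k < K) qexp_term w k) E ->
  mx_cvg (fun K => \sum_(k < K) qexp_term (q%:C * w) k) E' ->
  (1%:M - ((1 - q)%:C * w) *: A) *m E = E'.
Proof.
move=> x1 /(mx_cvgS _ _).2 hE /(mx_cvgS _ _).2 hE'.
apply: mx_cvg_unique (mx_cvgMl _ hE) _.
have x0 : 0 <= normc w * mxn A by rewrite mulr_ge0 ?normc_ge0 ?mxn_ge0.
have err : mx_cvg (fun K => - (w ^+ K.+1 * ((1 - q) * (qfact q K)^-1)%:C) *: A ^+ K.+1) 0.
  apply: (@mx_cvg_dominated _ _ _ _ _ (fun K => (normc w * mxn A) ^+ K)).
    move=> K; rewrite subr0 scaleNr mxnN.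
    apply: (@le_trans _ _ ((normc w * mxn A) ^+ K.+1)); last first.
      by rewrite exprS ler_piMl ?exprn_ge0 // ltW.
    rewrite mxnZ normcM normcX normcR exprMn -mulrA.
    rewrite ler_wpM2l ?exprn_ge0 ?normc_ge0 //.
    have f1 := qfact_ge1 K; have fV0 : 0 <= (qfact q K)^-1.
      by rewrite invr_ge0 (le_trans ler01).
    have q10 : 0 <= 1 - q by rewrite subr_ge0 ltW.
    rewrite ger0_norm ?mulr_ge0 //.
    rewrite (le_trans _ (mxnX A K)) // ler_piMl ?mxn_ge0 //.
    rewrite mulr_ile1 //; first by rewrite gerBl.
    by rewrite invf_le1 // (lt_le_trans ltr01).
  by apply: cvg_expr; rewrite ger0_norm.
have := mx_cvgD hE' err; rewrite addr0.
apply: (@mx_cvg_near _ _ _ _ _ _ 0) => K _.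
by rewrite qexp_functional_partial scaleNr.
Qed.

(** If [K] spans the left kernel, then [K = K X], so [mxn K] is at most [mxn X] times itself and
    vanishes. *)
Lemma unitmx_1B (X : 'M[C]_N) : mxn X < 1 -> 1%:M - X \in unitmx.
Proof.
move=> X1; rewrite -row_free_unit -kermx_eq0; apply/eqP/mxn0_eq0.
have : kermx (1%:M - X) *m (1%:M - X) = 0 by exact: mulmx_ker.
set K := kermx _; rewrite mulmxBr mulmx1 => /eqP; rewrite subr_eq0 => /eqP KX.
have := mxnM K X; rewrite -KX; have := mxn_ge0 K; nra.
Qed.

Definition qexp_factor (z : C) j := 1%:M - (((1 - q) * q ^+ j)%:C * z) *: A.

Lemma qexp_factor_unit z j : normc z * mxn A < 1 -> qexp_factor z j \in unitmx.
Proof.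
move=> x1; apply: unitmx_1B; rewrite mxnZ normcM normcR -mulrA.
apply: le_lt_trans x1; rewrite ler_piMl ?mulr_ge0 ?normc_ge0 ?mxn_ge0 //.
have q10 : 0 <= 1 - q by rewrite subr_ge0 ltW.
have qj0 : 0 <= q ^+ j by rewrite exprn_ge0.
rewrite ger0_norm ?mulr_ge0 // mulr_ile1 //; first by rewrite gerBl.
by rewrite exprn_ile1 // ltW.
Qed.

(** The radius [4^-1] gives [mxn (E(q^J z) - 1) <= 2^-1] for every [J], which controls the partial
    products without estimating the inverses one by one. *)
Lemma qexp_prod (z : C) : normc z * mxn A <= 4^-1 ->
  exists E, mx_cvg (fun K => \sum_(k < K) qexp_term z k) E /\
            mx_cvg (fun J => \prod_(j < J) invmx (qexp_factor z j)) E.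
Proof.
set x := normc z * mxn A => xh.
have x0 : 0 <= x by rewrite mulr_ge0 ?normc_ge0 ?mxn_ge0.
have [|E [hE _]] := @qexp_ex z; first by rewrite -/x; lra.
exists E; split=> //.
pose Pi J := \prod_(j < J) invmx (qexp_factor z j).
have nw J : normc ((q ^+ J)%:C * z) * mxn A = q ^+ J * x.
  by rewrite normcM normcR ger0_norm ?exprn_ge0 // -mulrA.
have nwh J : q ^+ J * x <= 4^-1.
  by apply: le_trans xh; rewrite ler_piMl // exprn_ile1 // ltW.
(* [E'] is [E(q^J z)]; each induction step appends one inverse factor and applies the functional
   equation once. *)
have step J : exists E', [/\ mx_cvg (fun K => \sum_(k < K) qexp_term ((q ^+ J)%:C * z) k) E',
    mxn (E' - 1%:M) <= 2 * (q ^+ J * x) & Pi J *m E' = E].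
  elim: J => [|J [E1 [c1 n1 e1]]].
    have [|E0 [c0 n0]] := @qexp_ex z; first by rewrite -/x; lra.
    exists E0; split; [by rewrite expr0 mul1r|by rewrite expr0 mul1r|].
    by rewrite /Pi big_ord0 mul1mx; apply: mx_cvg_unique c0 hE.
  have [|E2 [c2 n2]] := @qexp_ex ((q ^+ J.+1)%:C * z).
    by rewrite nw (le_trans (nwh _)) //; lra.
  exists E2; split=> //; first by rewrite -nw.
  have fe : qexp_factor z J *m E1 = E2.
    have w1 : normc ((q ^+ J)%:C * z) * mxn A < 1.
      by rewrite nw (le_lt_trans (nwh _)) //; lra.
    have c2' : mx_cvg (fun K => \sum_(k < K) qexp_term (q%:C * ((q ^+ J)%:C * z)) k) E2.
      by rewrite mulrA -rmorphM -exprS.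
    by have := qexp_functional w1 c1 c2'; rewrite mulrA -rmorphM.
  rewrite /Pi big_ord_recr /= -fe -[X in X *m _]/(_ *m _) -mulmxA mulKmx //.
  by apply: qexp_factor_unit; rewrite -/x; lra.
(* Self-bounding: [Pi J = E - Pi J (E' - 1)] with the last factor of norm at most [2^-1], so half of
   [mxn (Pi J)] is absorbed on the left. *)
have bnd J : mxn (Pi J) <= 2 * mxn E.
  have [E' [_ n' e']] := step J.
  have eP : Pi J = E - Pi J *m (E' - 1%:M).
    by rewrite mulmxBr e' mulmx1 opprB addrC subrK.
  have h1 : mxn (Pi J) <= mxn E + mxn (Pi J) * mxn (E' - 1%:M).
    rewrite {1}eP (le_trans (mxnD _ _)) // mxnN lerD2l; exact: mxnM.
  have h2 := mxn_ge0 (Pi J); have h3 := nwh J.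
  have h4 : mxn (Pi J) * mxn (E' - 1%:M) <= mxn (Pi J) * 2^-1.
    by rewrite ler_wpM2l //; lra.
  lra.
apply: (@mx_cvg_dominated _ _ _ _ _ (fun J => 4 * mxn E * x * q ^+ J)).
  move=> J; have [E' [_ n' e']] := step J.
  have -> : \prod_(j < J) invmx (qexp_factor z j) - E = - (Pi J *m (E' - 1%:M)).
    by rewrite mulmxBr e' mulmx1 opprB.
  rewrite mxnN (le_trans (mxnM _ _)) //.
  apply: (@le_trans _ _ (2 * mxn E * (2 * (q ^+ J * x)))).
    by rewrite ler_pM ?mxn_ge0.
  by rewrite le_eqVlt; apply/orP; left; apply/eqP; ring.
by apply: cvg_geometric; rewrite ger0_norm.
Qed.

End QExponential.

(** * Matrix power series: identity theorem and products with polynomials *)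

Section PowerSeries.
Variables (R : realType) (n m : nat).
Local Notation C := R[i].
Implicit Types (c : nat -> 'M[C]_(n, m)) (z : C).

Lemma near0P (P : C -> Prop) :
  near0 P <-> exists r : R, 0 < r /\ forall z, normc z < r -> P z.
Proof.
split=> [[[r r'] []]|[r [r0 h]]].
  rewrite ltcE /= => /andP [/eqP -> r0] h; exists r; split=> // z zr.
  by apply: h; rewrite norm_normc -[_ +i* _]/(r%:C) ltcR.
by exists r%:C; rewrite ltcR; split=> // z; rewrite norm_normc ltcR; apply: h.
Qed.

Lemma mx_cvg_bounded p r (u : nat -> 'M[C]_(p, r)) L :
  mx_cvg u L -> exists b : R, forall k, mxn (u k) <= b.
Proof.
move=> /mx_cvgP /cvgr0Pnorm_lt /(_ 1 ltr01) [K _ HK].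
exists (\sum_(k < K) mxn (u k) + (1 + mxn L)) => k.
have [Kk|kK] := leqP K k.
  have := HK k Kk; rewrite /= ger0_norm ?mxn_ge0 // => h.
  have -> : u k = (u k - L) + L by rewrite subrK.
  rewrite (le_trans (mxnD _ _)) // -[leLHS]add0r lerD ?sumr_ge0 // => [i _|].
    exact: mxn_ge0.
  by rewrite lerD // ltW.
rewrite (bigD1 (Ordinal kK)) //= -addrA lerDl !addr_ge0 ?mxn_ge0 //.
by apply: sumr_ge0 => i _; apply: mxn_ge0.
Qed.

Lemma mx_series_bounded c z L : mx_series_to c z L ->
  exists b : R, 0 < b /\ forall k, normc z ^+ k * mxn (c k) <= b.
Proof.
move=> /mx_cvg_bounded [b hb]; exists (b + b + 1).
have b0 : 0 <= b := le_trans (mxn_ge0 _) (hb 0%N).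
split=> [|k]; first by lra.
have -> : normc z ^+ k * mxn (c k) =
    mxn (\sum_(i < k.+1) z ^+ i *: c i - \sum_(i < k) z ^+ i *: c i).
  by rewrite big_ord_recr /= addrAC subrr add0r mxnZ normcX.
rewrite (le_trans (mxnD _ _)) // mxnN.
by have := hb k; have := hb k.+1; lra.
Qed.

(** Identity theorem for zeros accumulating at 0. By strong induction the coefficients before [c k]
    vanish, so [z^k c_k] is minus the tail, which is [O(z^(k+1))]; dividing by [z^k] and letting [z]
    tend to 0 gives [c k = 0]. *)
Lemma mx_series_eq0 c :
  near0 (fun z => exists L, mx_series_to c z L) ->
  (forall e : R, 0 < e -> exists z, 0 < normc z < e /\ mx_series_to c z 0) ->
  forall k, c k = 0.
Proof.
move=> /near0P [r [r0 hr]] zer.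
have [|L hL] := hr (r / 2)%:C.
  by rewrite normcR ger0_norm; lra.
have [b [b0 hb]] := mx_series_bounded hL.
move: hb; rewrite normcR ger0_norm; last by lra.
set s := r / 2 => hb; have s0 : 0 < s by rewrite /s; lra.
elim/ltn_ind => k IH; apply: mxn0_eq0; apply/ler_addgt0Pr => e e0; rewrite add0r.
(* The estimate [mxn (c i) <= b / s^i] bounds the tail by [2 * b * (normc z / s)^(k+1)]; dividing by
   [normc z ^+ k] leaves [M * normc z]. *)
pose M := 2 * b / s ^+ k.+1.
have M0 : 0 < M by rewrite /M divr_gt0 ?mulr_gt0 ?exprn_gt0.
(* The bound [s / 2] keeps the ratio [y] at most one half; [e / M] makes the final estimate at most
   [e]. *)
have [|z [/andP [z0 ze] hz]] := zer (Num.min (s / 2) (e / M)).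
  by rewrite lt_min (divr_gt0 s0) // (divr_gt0 e0).
move: ze; rewrite lt_min => /andP [zs ze].
suff : mxn (c k) <= M * normc z.
  by move=> /le_trans; apply; rewrite mulrC -ler_pdivlMr // ltW.
pose y := normc z / s.
have y0 : 0 <= y by rewrite divr_ge0 ?normc_ge0 // ltW.
have yh : y <= 2^-1 by rewrite /y ler_pdivrMr // mulrC ltW.
have cb i : normc z ^+ i * mxn (c i) <= b * y ^+ i.
  have -> : normc z ^+ i = y ^+ i * s ^+ i.
    by rewrite -exprMn /y divfK // gt_eqF.
  by rewrite -mulrA [leRHS]mulrC ler_wpM2l ?exprn_ge0.
have key : normc z ^+ k * mxn (c k) <= b * y ^+ k.+1 * 2.
  rewrite -normcX -mxnZ.
  (* Since the full sum is 0, the negated finite tails converge to [z^k c_k], and they obey a bound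
     independent of [K]. *)
  have hz' : mx_cvg (fun K => z ^+ k *: c k - \sum_(i < k.+1 + K) z ^+ i *: c i) (z ^+ k *: c k).
    have h0 : mx_cvg (fun K => \sum_(i < k.+1 + K) z ^+ i *: c i) 0.
      move=> i j d d0; have [K HK] := hz i j d d0; exists K => l Kl.
      by apply: HK; rewrite (leq_trans Kl) // leq_addl.
    have := mx_cvgD (mx_cvg_cst (z ^+ k *: c k)) (mx_cvgZ (-1) h0).
    rewrite scaler0 addr0; apply: (@mx_cvg_near _ _ _ _ _ _ 0) => K _.
    by rewrite scaleN1r.
  apply: (mxn_cvg_le hz') => K.
  rewrite big_split_ord /= big_ord_recr /= big1 ?add0r; last first.
    by move=> i _; rewrite IH ?scaler0.
  rewrite opprD addrA subrr add0r mxnN (le_trans (mxn_sum _ _ _)) //.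
  apply: (@le_trans _ _ (\sum_(i < K) b * y ^+ k.+1 * y ^+ i)).
    by apply: ler_sum => i _; rewrite mxnZ normcX -mulrA -exprD cb.
  by rewrite -mulr_sumr ler_wpM2l ?geometric_sum_le2 ?y0 // mulr_ge0 ?exprn_ge0 // ltW.
have zk0 : 0 < normc z ^+ k by rewrite exprn_gt0.
rewrite -(ler_pM2l zk0); apply: le_trans key _.
rewrite /y expr_div_n exprSr /M le_eqVlt; apply/orP; left; apply/eqP.
by field; rewrite expf_neq0 ?gt_eqF.
Qed.

(** Cauchy product: the coefficients of [d(z)] times the series [c]. *)
Definition poly_conv (d : {poly C}) c k : 'M[C]_(n, m) :=
  \sum_(i < k.+1) d`_i *: c (k - i)%N.

Definition mx_shift c k : 'M[C]_(n, m) := if k is k'.+1 then c k' else 0.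

Lemma mx_series_shift c z L :
  mx_series_to c z L -> mx_series_to (mx_shift c) z (z *: L).
Proof.
move=> /(mx_cvgZ z) h; apply/mx_cvgS; move: h.
apply: (@mx_cvg_near _ _ _ _ _ _ 0) => K _.
rewrite big_ord_recl /= scaler0 add0r scaler_sumr.
by apply: eq_bigr => i _; rewrite scalerA -exprS.
Qed.

Lemma mx_series_ext c c' z L : c =1 c' -> mx_series_to c z L -> mx_series_to c' z L.
Proof. by move=> /funext ->. Qed.

Lemma mx_seriesD c c' z L L' : mx_series_to c z L -> mx_series_to c' z L' ->
  mx_series_to (fun k => c k + c' k) z (L + L').
Proof.
move=> h h'; have := mx_cvgD h h'; apply: (@mx_cvg_near _ _ _ _ _ _ 0) => K _.
by rewrite -big_split; apply: eq_bigr => i _; rewrite scalerDr.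
Qed.

Lemma mx_seriesZ a c z L : mx_series_to c z L ->
  mx_series_to (fun k => a *: c k) z (a *: L).
Proof.
move=> /(mx_cvgZ a); apply: (@mx_cvg_near _ _ _ _ _ _ 0) => K _.
by rewrite scaler_sumr; apply: eq_bigr => i _; rewrite !scalerA mulrC.
Qed.

(** Induction along Horner's scheme uses only shifting, scaling and adding series, so no double
    series has to be rearranged. *)
Lemma mx_series_poly_conv d c z L :
  mx_series_to c z L -> mx_series_to (poly_conv d c) z (d.[z] *: L).
Proof.
move=> h; elim/poly_ind: d => [|d a IH].
  rewrite horner0; apply: mx_series_ext (mx_seriesZ 0 h) => k.
  by rewrite scale0r /poly_conv big1 // => i _; rewrite coef0 scale0r.
rewrite hornerMXaddC scalerDl [_ * z]mulrC -scalerA.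
have := mx_seriesD (mx_series_shift IH) (mx_seriesZ a h).
apply: mx_series_ext => k.
rewrite [in RHS]/poly_conv big_ord_recl coefD coefMX coefC !eqxx add0r subn0 addrC.
congr (_ + _); case: k => [|k]; first by rewrite big_ord0.
by rewrite /= /poly_conv; apply: eq_bigr => i _; rewrite coefD coefMX coefC addr0.
Qed.

Lemma mx_series_poly (P : 'M[{poly C}]_(n, m)) z :
  mx_series_to (fun k => map_mx (fun p : {poly C} => p`_k) P) z (map_mx (fun p => p.[z]) P).
Proof.
pose s := \max_i \max_j size (P i j).
apply: (@mx_cvg_near _ _ _ (fun=> map_mx (fun p => p.[z]) P) _ _ s); last first.
  exact: mx_cvg_cst.
move=> K sK; apply/matrixP => i j; rewrite mxE summxE.
rewrite (@horner_coef_wide _ K); last first.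
  apply: leq_trans sK; apply: leq_trans (leq_bigmax i).
  exact: (leq_bigmax (F := fun j => size (P i j))).
by apply: eq_bigr => k _; rewrite !mxE mulrC.
Qed.

(** There are finitely many roots, and [r] is at most the least modulus of the nonzero ones. The
    origin is excluded since it may itself be a root. *)
Lemma poly_neq0_punctured (d : {poly C}) : d != 0 ->
  exists r : R, 0 < r /\ forall z, 0 < normc z < r -> d.[z] != 0.
Proof.
move=> d0; have [s ds] := closed_field_poly_normal d.
suff [r [r0 hr]] : exists r : R, 0 < r /\ forall z, z \in s -> 0 < normc z -> r <= normc z.
  exists r; split=> // z /andP [z0 zr]; apply/negP => dz.
  have : root d z by [].
  rewrite ds rootZ ?lead_coef_eq0 // root_prod_XsubC => /hr /(_ z0).
  by rewrite leNgt zr.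
elim: s {ds} => [|x s [r [r0 hr]]]; first by exists 1.
have [x0|x0] := eqVneq (normc x) 0.
  exists r; split=> // z; rewrite inE => /orP [/eqP -> |/hr //].
  by rewrite x0 ltxx.
exists (Num.min r (normc x)); split.
  by rewrite lt_min r0 lt_neqAle eq_sym x0 normc_ge0.
move=> z; rewrite inE ge_min => /orP [/eqP -> |/hr h /h ->//].
by rewrite lexx orbT.
Qed.

(** Near 0 the series of [d F - P] sums to 0 wherever [d] does not vanish, and such points
    accumulate at 0, so the identity theorem applies. *)
Lemma rational_series_coef (F : C -> 'M[C]_(n, m)) (Fk : nat -> 'M[C]_(n, m))
    (P : 'M[{poly C}]_(n, m)) (d : {poly C}) : d != 0 ->
  (forall z, d.[z] != 0 -> F z = (d.[z])^-1 *: map_mx (fun p => p.[z]) P) ->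
  near0 (fun z => mx_series_to Fk z (F z)) ->
  forall k, poly_conv d Fk k = map_mx (fun p : {poly C} => p`_k) P.
Proof.
move=> d0 FP /near0P [r [r0 hr]] k; apply/eqP; rewrite -subr_eq0; apply/eqP.
rewrite -scaleN1r; move: k.
pose g k := poly_conv d Fk k + -1 *: map_mx (fun p : {poly C} => p`_k) P.
have hg z : normc z < r ->
    mx_series_to g z (d.[z] *: F z + -1 *: map_mx (fun p => p.[z]) P).
  move=> /hr h.
  exact: mx_seriesD (mx_series_poly_conv d h) (mx_seriesZ (-1) (mx_series_poly P z)).
apply: (@mx_series_eq0 g).
  by apply/near0P; exists r; split=> // z /hg h; eexists; exact: h.
move=> e e0; have [r' [r'0 hr']] := poly_neq0_punctured d0.
pose t := Num.min r (Num.min r' e).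
have t0 : 0 < t by rewrite !lt_min r0 r'0.
(* The real point [t / 2] lies in the disc of convergence, avoids the roots of [d] and is below
   [e]. *)
exists (t / 2)%:C; rewrite normcR ger0_norm; last by rewrite ltW // divr_gt0.
have t2 : t / 2 < t by lra.
have [tr tr' te] : [/\ t <= r, t <= r' & t <= e] by rewrite /t !ge_min !lexx !orbT.
split; first by rewrite divr_gt0 // (lt_le_trans t2).
have nt : normc (t / 2)%:C = t / 2 by rewrite normcR ger0_norm // ltW // divr_gt0.
have dz : d.[(t / 2)%:C] != 0 by apply: hr'; rewrite nt divr_gt0 // (lt_le_trans t2).
have := hg (t / 2)%:C; rewrite nt (lt_le_trans t2) // => /(_ isT).
by rewrite FP // scalerA divff // scale1r scaleN1r subrr.
Qed.

End PowerSeries.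

(** * The resolvent as a power series and as a rational function *)

Section Resolvent.
Variable R : realType.
Local Notation C := R[i].

Lemma near0_small N (A : 'M[C]_N) : near0 (fun z => normc z * mxn A <= 4^-1).
Proof.
(* Adding 1 avoids a zero denominator when [A = 0]. *)
apply/near0P; exists (4^-1 / (mxn A + 1)).
have A1 : 0 < mxn A + 1 by rewrite ltr_wpDl ?mxn_ge0.
split=> [|z]; first by rewrite divr_gt0.
rewrite ltr_pdivlMr // => /ltW; apply: le_trans.
by rewrite ler_wpM2l ?normc_ge0 // lerDl.
Qed.

Lemma near0W (P Q : C -> Prop) : (forall z, P z -> Q z) -> near0 P -> near0 Q.
Proof. by move=> PQ [r [r0 h]]; exists r; split=> // z /h /PQ. Qed.

Lemma near0I (P Q : C -> Prop) :
  near0 P -> near0 Q -> near0 (fun z => P z /\ Q z).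
Proof.
move=> /near0P [r [r0 h]] /near0P [s [s0 k]]; apply/near0P.
exists (Num.min r s); rewrite lt_min r0; split=> // z; rewrite lt_min.
by move=> /andP [/h ? /k ?].
Qed.

Variables (n m N : nat) (Cm : 'M[C]_(n, N)) (A : 'M[C]_N) (B : 'M[C]_(N, m)).

Lemma mx_series_qexp (q : R) z E :
  mx_cvg (fun K => \sum_(k < K) qexp_term q A z k) E ->
  mx_series_to (fun k => ((qfact q k)^-1)%:C *: (Cm *m A ^+ k *m B)) z (Cm *m E *m B).
Proof.
move=> /(mx_cvgMl Cm) /(mx_cvgMr B); apply: (@mx_cvg_near _ _ _ _ _ _ 0) => K _.
rewrite mulmx_sumr mulmx_suml; apply: eq_bigr => k _.
by rewrite /qexp_term -!scalemxAr -!scalemxAl.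
Qed.

Lemma qfact0 k : qfact (0 : R) k = 1.
Proof.
rewrite /qfact big1 // => j _; rewrite /qint big_ord_recl expr0 big1 ?addr0 //.
by move=> i _; rewrite exprS mul0r.
Qed.

(* The resolvent is the case q = 0 of the infinite product. *)
Lemma mx_series_resolvent z : normc z * mxn A <= 4^-1 ->
  mx_series_to (fun k => Cm *m A ^+ k *m B) z (Cm *m invmx (1%:M - z *: A) *m B).
Proof.
move=> h; have [E [cE cP]] := qexp_prod (lexx 0) ltr01 h.
have -> : invmx (1%:M - z *: A) = E.
  (* Only the factor [j = 0] differs from the identity, as [0 ^+ 0 = 1], so the products are
     constant from length 1 on; [mx_cvgS] drops the empty one. *)
  apply: mx_cvg_unique cP; apply/mx_cvgS.
  apply: (@mx_cvg_near _ _ _ (fun=> invmx (1%:M - z *: A)) _ _ 0); last first.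
    exact: mx_cvg_cst.
  move=> J _; rewrite big_ord_recl big1 ?mulr1.
    by rewrite /qexp_factor expr0 subr0 !mul1r.
  move=> j _; rewrite /qexp_factor /= exprS mul0r mulr0 mul0r scale0r subr0.
  exact: invmx1.
apply: mx_series_ext (mx_series_qexp cE) => k.
by rewrite qfact0 invr1 scale1r.
Qed.

Definition resolvent_den : {poly C} := \det (1%:M - 'X *: map_mx polyC A).
Definition resolvent_num : 'M[{poly C}]_(n, m) :=
  map_mx polyC Cm *m \adj (1%:M - 'X *: map_mx polyC A) *m map_mx polyC B.

(** Evaluation at [z] is a ring morphism, hence commutes with determinant and adjugate; through this
    identity Cramer's rule passes from the polynomial pencil to [1 - z A]. *)
Lemma map_horner_pencil z :
  map_mx (horner_eval z) (1%:M - 'X *: map_mx polyC A) = 1%:M - z *: A.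
Proof.
apply/matrixP => i j; rewrite !mxE /horner_eval !hornerE.
by case: (i == j); rewrite ?hornerE.
Qed.

Lemma map_horner_polyC p r (X : 'M[C]_(p, r)) z :
  map_mx (horner_eval z) (map_mx polyC X) = X.
Proof. by apply/matrixP => i j; rewrite !mxE /horner_eval hornerC. Qed.

Lemma resolvent_denE z : resolvent_den.[z] = \det (1%:M - z *: A).
Proof. by rewrite -/(horner_eval z _) -det_map_mx map_horner_pencil. Qed.

Lemma resolvent_numE z :
  map_mx (fun p => p.[z]) resolvent_num = Cm *m \adj (1%:M - z *: A) *m B.
Proof.
rewrite -[LHS]/(map_mx (horner_eval z) _) !map_mxM map_mx_adj.
by rewrite map_horner_pencil !map_horner_polyC.
Qed.

Lemma resolvent_rational z : 1%:M - z *: A \in unitmx ->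
  Cm *m invmx (1%:M - z *: A) *m B =
  (resolvent_den.[z])^-1 *: map_mx (fun p => p.[z]) resolvent_num.
Proof.
move=> u; rewrite resolvent_denE resolvent_numE /invmx u.
by rewrite -scalemxAr -scalemxAl.
Qed.

Lemma resolvent_den_neq0 : resolvent_den != 0.
Proof.
apply/eqP => h; have := resolvent_denE 0.
by rewrite h horner0 scale0r subr0 det1 => /esym /eqP; rewrite oner_eq0.
Qed.

End Resolvent.

(** * Equivalence of q-rational functions and q-Borel transforms of rational functions *)

Theorem theorem5p7 (R : realType) (n m : nat) (q : R)
    (T : R[i] -> 'M[R[i]]_(n, m)) :
  0 <= q -> q < 1 -> analytic_at0 T ->
  (q_rational q T <->
   exists F : R[i] -> 'M[R[i]]_(n, m),
     is_rational_fun F /\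
     exists Fk : nat -> 'M[R[i]]_(n, m),
       near0 (fun z => mx_series_to Fk z (F z)) /\
       near0 (fun z => mx_series_to (fun k => ((qfact q k)^-1)%:C *: Fk k) z (T z))).
Proof.
move=> q0 q1 _; split.
  move=> [N [Cm [A [B hT]]]].
  (* In the form numerator over denominator, [F] is rational by definition; near 0 it agrees with
     the resolvent [C (1 - z A)^-1 B]. *)
  exists (fun z => ((resolvent_den A).[z])^-1 *:
            map_mx (fun p => p.[z]) (resolvent_num Cm A B)).
  split.
    by exists (resolvent_num Cm A B), (resolvent_den A); rewrite resolvent_den_neq0.
  exists (fun k => Cm *m A ^+ k *m B); split.
    apply: near0W (near0_small A) => z hz.
    rewrite -resolvent_rational; first exact: mx_series_resolvent.
    by apply: unitmx_1B; rewrite mxnZ; lra.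
  apply: near0W (near0I hT (near0_small A)) => z [[_ [P [cP ->]]] hz].
  have [E [cE cP']] := qexp_prod q0 q1 hz.
  by rewrite (mx_cvg_unique cP cP'); exact: mx_series_qexp.
move=> [F [[P [d [d0 FP]]] [Fk [hF hT]]]].
have coefE := rational_series_coef d0 FP hF.
(* Every entry of [Fk] satisfies a recurrence with the common denominator [d], so a realization
   exists entrywise and is then assembled. *)
have [N [Cm [A [B FkE]]]] : realizable Fk.
  apply: realizable_entries => i j.
  apply: (@realizable_poly_conv _ d (P i j)) => // k.
  have /matrixP /(_ i j) := coefE k.
  rewrite mxE => <-; rewrite /poly_conv summxE.
  by apply: eq_bigr => l _; rewrite mxE.
exists N, Cm, A, B; apply: near0W (near0I hT (near0_small A)) => z [cT hz].
split; first by move=> j; apply: (qexp_factor_unit q0 q1); lra.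
have [E [cE cP]] := qexp_prod q0 q1 hz.
(* [T z] and [C E B] are sums of the same series, hence equal. *)
exists E; split=> //; apply: (mx_cvg_unique cT).
rewrite -[mx_cvg _ _]/(mx_series_to (fun k => ((qfact q k)^-1)%:C *: Fk k) z _).
by apply: mx_series_ext (mx_series_qexp Cm B cE) => k; rewrite FkE.
Qed.
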